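(* Let $b$ be a positive integer, let $0<\alpha<1$, and let ${f:{}_{b}\mathbb{N}\to\mathbb{R}}$ be a function with $f(b)\ge 0$. Suppose ${}_{b}\Delta^{\alpha}f(u)\ge 0$ for all $u\in{}_{b-(1-\alpha)}\mathbb{N}$. Then $f$ is $\alpha$-decreasing on ${}_{b}\mathbb{N}$, that is, $f(t)\ge\alpha f(t+1)$ for all $t\in{}_{b-1}\mathbb{N}$.
   Context: For a real number $c$, ${}_{c}\mathbb{N}=\{c,c-1,c-2,\dots\}$. $\nabla f(t)=f(t)-f(t-1)$, $\sigma(t)=t+1$. The falling function is $x^{(\beta)}=\Gamma(x+1)/\Gamma(x+1-\beta)$, with the convention that division at a pole yields zero. The delta right fractional sum of order $\beta>0$ ending at $b$ is ${}_{b}\Delta^{-\beta}f(t)=\frac{1}{\Gamma(\beta)}\sum_{s=t+\beta}^{b}(s-\sigma(t))^{(\beta-1)}f(s)$, $t\in{}_{b-\beta}\mathbb{N}$. For $0<\alpha<1$ the delta right (Riemann) fractional difference is ${}_{b}\Delta^{\alpha}f(t)=-\nabla\,{}_{b}\Delta^{-(1-\alpha)}f(t)$, $t\in{}_{b-(1-\alpha)}\mathbb{N}$. *)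

(* Defs.v *)
From HB Require Import structures.
From mathcomp Require Import all_boot all_order all_algebra.
From mathcomp Require Import all_classical all_reals all_analysis.
Set Implicit Arguments.
Unset Strict Implicit.
Unset Printing Implicit Defensive.
Import Order.TTheory GRing.Theory Num.Theory.
Local Open Scope classical_set_scope.
Local Open Scope ring_scope.

(* Euler's integral of the second kind; meaningful for x > 0. *)
Definition euler_Gamma (R : realType) (x : R) : R :=
  \int[lebesgue_measure]_(t in `]0, +oo[) (t `^ (x - 1) * expR (- t)).

(* The Gamma function on the whole real line: for x <= 0 it is continued by
   Gamma x = Gamma (x + n) / (x (x + 1) ... (x + n - 1)), where n is the least
   natural number with x + n > 0. At a pole (x = 0, -1, -2, ...) the product
   contains the factor 0, so Gamma x = 0 because 0^-1 = 0, and therefore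
   y / Gamma x = 0: division at a pole yields zero. *)
Definition Gamma (R : realType) (x : R) : R :=
  if 0 < x then euler_Gamma x
  else let n := (Num.truncn (- x)).+1 in
       euler_Gamma (x + n%:R) / \prod_(i < n) (x + i%:R).

(* x^(beta) *)
Definition falling (R : realType) (x beta : R) : R :=
  Gamma (x + 1) / Gamma (x + 1 - beta).

(* {c, c - 1, c - 2, ...} *)
Definition downN (R : realType) (c : R) : set R :=
  [set t | exists k : nat, t = c - k%:R].

Definition nabla (R : realType) (f : R -> R) (t : R) : R := f t - f (t - 1).

Definition sigma (R : realType) (t : R) : R := t + 1.

(* Functions on downN c are represented by total functions R -> R; the operators
   below only use the values of f on downN b. For t in downN (b - beta) the
   index set is {t + beta, t + beta + 1, ..., b}. *)
Definition right_sum (R : realType) (b beta : R) (f : R -> R) (t : R) : R :=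
  (Gamma beta)^-1 *
  \sum_(s \in downN b `&` `[t + beta, +oo[)
     falling (s - sigma t) (beta - 1) * f s.

Definition right_diff (R : realType) (b alpha : R) (f : R -> R) (t : R) : R :=
  - nabla (right_sum b (1 - alpha) f) t.

Definition alpha_decreasing (R : realType) (b alpha : R) (f : R -> R) : Prop :=
  forall t, downN (b - 1) t -> f t >= alpha * f (t + 1).

(* Main.v *)
(* With beta = 1 - alpha and w_m = Gamma(m + beta) / (Gamma(beta) m!), the right
   sum at b - beta - k is S_k = \sum_(j <= k) w_(k-j) f(b - j). The functional
   equation of Gamma gives w_0 = 1 and w_(m+1) - w_m = - alpha w_m / (m + 1), so
   S_(k+1) - S_k >= 0 reads
     f(b - k - 1) >= \sum_(j <= k) alpha w_(k-j) / (k - j + 1) f(b - j).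
   All these coefficients are positive, hence f >= 0 by strong induction, and
   keeping only the term j = k on the right gives f(b - k - 1) >= alpha f(b - k). *)
Require Import Defs.
From mathcomp Require Import all_boot all_order all_algebra.
From mathcomp Require Import all_classical all_reals all_analysis.
From mathcomp Require Import measurable_realfun ring.
Import Order.TTheory GRing.Theory Num.Theory.
Import numFieldNormedType.Exports.
Local Open Scope classical_set_scope.
Local Open Scope ring_scope.

(** * Euler's integral: truncation and integration by parts *)

(** Values in the extended reals allow limits and integration by parts before finiteness is known;
    [euler_Gamma] is the [fine] of this integral. *)
Definition gamma_integral {R : realType} (x : R) : \bar R :=
  (\int[lebesgue_measure]_(t in `]0%R, +oo[) (t `^ (x - 1) * expR (- t))%:E)%E.

Lemma gamma_integrand_ge0 {R : realType} (x t : R) :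
  0 <= t `^ (x - 1) * expR (- t).
Proof. by rewrite mulr_ge0 ?powR_ge0 ?expR_ge0. Qed.

Lemma measurable_gamma_integrand {R : realType} (x : R) (A : set R) :
  measurable_fun A (EFin \o (fun t : R => t `^ (x - 1) * expR (- t))).
Proof.
apply/measurable_EFinP; apply: measurable_funTS; apply: measurable_funM.
  exact: measurable_powR.
by apply: measurableT_comp => //; exact: measurable_expR.
Qed.

(** Monotone convergence along compact intervals exhausting the half-line. They avoid 0, where
    powers may fail to be differentiable, and the shift by 2 makes them nondegenerate already for
    [n = 0]. *)
Lemma cvg_gamma_integral {R : realType} (x : R) :
  (\int[lebesgue_measure]_(t in `[n.+2%:R^-1%R, n.+2%:R%R])
     (t `^ (x - 1) * expR (- t))%:E)%E @[n --> \oo] --> gamma_integral x.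
Proof.
rewrite /gamma_integral.
have -> : [set` `]0 : R, +oo[] = \bigcup_n [set` `[n.+2%:R^-1 : R, n.+2%:R]].
  apply/seteqP; split => [t /=|t [n _] /=].
    rewrite in_itv/= andbT => t0.
    (* The index must bound both [t] and [t^-1]. *)
    exists (maxn (Num.truncn t) (Num.truncn t^-1)) => //=.
    rewrite in_itv/=; apply/andP; split.
      rewrite invf_ple ?posrE//; apply: ltW; apply: lt_le_trans (truncnS_gt _) _.
      by rewrite ler_nat ltnS leqW// leq_maxr.
    apply: ltW; apply: lt_le_trans (truncnS_gt _) _.
    by rewrite ler_nat ltnS leqW// leq_maxl.
  by rewrite !in_itv/= andbT => /andP[+ _]; apply: lt_le_trans; rewrite invr_gt0.
apply: ge0_nondecreasing_set_cvg_integral => //.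
- move=> m n mn; apply/subsetPset => t /=; rewrite !in_itv/= => /andP[mt tm].
  apply/andP; split.
    by apply: le_trans mt; rewrite lef_pV2 ?posrE// ler_nat.
  by apply: le_trans tm _; rewrite ler_nat.
- by move=> i; exact: measurable_gamma_integrand.
- by move=> i t _; rewrite lee_fin gamma_integrand_ge0.
Qed.

Lemma continuous_expRN {R : realType} : continuous (fun t : R => expR (- t)).
Proof.
by move=> t; apply: continuous_comp; [exact: opp_continuous|exact: continuous_expR].
Qed.

Lemma is_derive_oppr_expRN {R : realType} (t : R) :
  is_derive t 1 (fun t => - expR (- t)) (expR (- t)).
Proof. by apply: is_derive_eq; last by rewrite mulrN1 opprK. Qed.

Lemma continuous_powR {R : realType} (x t : R) : 0 < t ->
  {for t, continuous (fun u : R => u `^ x)}.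
Proof.
move=> t0; apply: differentiable_continuous; apply/derivable1_diffP.
by apply: derivable_powR; rewrite in_itv/= t0.
Qed.

Lemma derivable_oo_LRcontinuous_powR {R : realType} (x a b : R) : 0 < a -> a < b ->
  derivable_oo_LRcontinuous (fun t : R => t `^ x) a b.
Proof.
move=> a0 ab; split.
- move=> t; rewrite in_itv/= => /andP[at_ _].
  by apply: derivable_powR; rewrite in_itv/= (lt_trans a0).
- exact/cvg_at_right_filter/continuous_powR.
- by apply/cvg_at_left_filter/continuous_powR; rewrite (lt_trans a0).
Qed.

(** The power is differentiated and [expR (- t)] is integrated to [- expR (- t)]; [x + 1 - 1] is
    kept to match the integrand of [gamma_integral (x + 1)]. *)
Lemma gamma_by_parts {R : realType} (x a b : R) : 0 <= x -> 0 < a -> a < b ->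
  (\int[lebesgue_measure]_(t in `[a, b]) (t `^ (x + 1 - 1) * expR (- t))%:E =
   (a `^ x * expR (- a) - b `^ x * expR (- b))%:E +
   x%:E * \int[lebesgue_measure]_(t in `[a, b]) (t `^ (x - 1) * expR (- t))%:E)%E.
Proof.
move=> x0 a0 ab; rewrite addrK.
have cP y : {within `[a, b], continuous (fun t : R => t `^ y)}.
  exact/derivable_oo_LRcontinuous_within/derivable_oo_LRcontinuous_powR.
rewrite (@integration_by_parts _ (fun t => t `^ x) (fun t => - expR (- t))
   (fun t => x * t `^ (x - 1)) (fun t => expR (- t)) a b ab).
- under [X in (_ - X)%E]eq_integral do rewrite mulrN -mulrA EFinN.
  rewrite integral_ge0N; last first.
    by move=> t _; rewrite lee_fin mulr_ge0 ?gamma_integrand_ge0.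
  rewrite oppeK; congr (_ + _)%E.
    by rewrite !mulrN opprK addrC.
  under eq_integral do rewrite EFinM.
  rewrite ge0_integralZl//.
  + exact: measurable_gamma_integrand.
  + by move=> t _; rewrite lee_fin gamma_integrand_ge0.
- move=> t; apply: (@continuousM R (subspace [set` `[a, b]])
    (fun=> x) (fun t => t `^ (x - 1))); first exact: cvg_cst.
  exact: cP.
- exact: derivable_oo_LRcontinuous_powR.
- move=> t; rewrite in_itv/= => /andP[at_ _].
  by apply: powR_derive1; rewrite in_itv/= (lt_trans a0).
- apply: continuous_subspaceT; exact: continuous_expRN.
- split.
  + by move=> t _; exact: (@ex_derive _ _ _ _ _ _ _ (is_derive_oppr_expRN t)).
  + apply/cvg_at_right_filter; apply: cvgN; exact: continuous_expRN.
  + apply/cvg_at_left_filter; apply: cvgN; exact: continuous_expRN.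
- by move=> t _; rewrite derive1E;
  exact: (@derive_val _ _ _ _ _ _ _ (is_derive_oppr_expRN t)).
Qed.

(** * Vanishing boundary terms and the functional equation *)

Lemma cvg_invSS {R : realType} : (n.+2%:R^-1 : R) @[n --> \oo] --> 0.
Proof. by have := @cvg_harmonic R; rewrite -cvg_shiftS. Qed.

Lemma gamma_boundary0 {R : realType} (x : R) : 0 < x ->
  (n.+2%:R^-1 `^ x * expR (- n.+2%:R^-1) : R) @[n --> \oo] --> 0.
Proof.
move=> x0; apply: (@squeeze_cvgr _ _ _ _ (fun=> 0) (fun n => n.+2%:R^-1 `^ x)).
- near=> n; rewrite mulr_ge0 ?powR_ge0 ?expR_ge0//=.
  by rewrite ler_piMr ?powR_ge0// -expR0 ler_expR oppr_le0 invr_ge0.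
- exact: cvg_cst.
- move/cvg_at_rightP : (powR_cvg0 x0); apply; split; last exact: cvg_invSS.
  by move=> n; rewrite invr_gt0.
Unshelve. all: end_near. Qed.

(** For a natural number [k >= x] and [y >= 1], the exponential series gives
    [expR y >= y ^+ k.+1 / (k.+1)]![, so the term at]y[is at most](k.+1)[! / y]. *)
Lemma gamma_boundaryy {R : realType} (x : R) :
  (n.+2%:R `^ x * expR (- n.+2%:R) : R) @[n --> \oo] --> 0.
Proof.
pose k := (Num.truncn x).+1.
have xk : x <= k%:R by apply: ltW; exact: truncnS_gt.
apply: (@squeeze_cvgr _ _ _ _ (fun=> 0) (fun n => (k.+1)`!%:R * n.+2%:R^-1)).
- near=> n; rewrite mulr_ge0 ?powR_ge0 ?expR_ge0//=.
  rewrite expRN ler_pdivrMr ?expR_gt0//.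
  have n1 : 1 <= n.+2%:R :> R by rewrite ler1n.
  apply: (le_trans (ler_powR n1 xk)); rewrite powR_mulrn//.
  apply: (@le_trans _ _ ((k.+1)`!%:R * n.+2%:R^-1 *
      (n.+2%:R ^+ k.+1 / (k.+1)`!%:R))); last first.
    rewrite ler_wpM2l ?mulr_ge0//.
    by apply: le_trans (expR_ge1Dxn k _) => //; rewrite lerDr.
  rewrite exprS le_eqVlt; apply/orP; left; apply/eqP; field.
  by rewrite -natrD !pnatr_eq0 -lt0n fact_gt0.
- exact: cvg_cst.
- rewrite -[X in _ --> X](mulr0 (k.+1)`!%:R).
  by apply: cvgM; [exact: cvg_cst|exact: cvg_invSS].
Unshelve. all: end_near. Qed.

Lemma gamma_integral_ge0 {R : realType} (x : R) : (0 <= gamma_integral x)%E.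
Proof. by apply: integral_ge0 => t _; rewrite lee_fin gamma_integrand_ge0. Qed.

(** Limit of [gamma_by_parts] over the truncations: both boundary terms tend to 0. *)
Lemma gamma_integralS {R : realType} (x : R) : 0 < x ->
  (gamma_integral (x + 1) = x%:E * gamma_integral x)%E.
Proof.
move=> x0; apply: (cvg_unique _ (cvg_gamma_integral (x + 1))) => //=.
under eq_cvg => n.
  rewrite gamma_by_parts ?ltW// ?invr_gt0//; last first.
    by apply: (@lt_trans _ _ 1); rewrite ?invf_lt1 ?ltr1n.
  over.
rewrite -[(x%:E * _)%E]add0e; apply: cvgeD => //.
  apply: cvg_EFin; first by near=> n.
  rewrite -[X in _ --> X](subr0 0); apply: cvgB.
    exact: gamma_boundary0.
  exact: gamma_boundaryy.
by apply: cvgeZl => //; exact: cvg_gamma_integral.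
Unshelve. all: end_near. Qed.

Lemma gamma_integral1 {R : realType} : (gamma_integral (1 : R) = 1)%E.
Proof.
rewrite /gamma_integral integral_itv_obnd_cbnd; last first.
  exact: measurable_gamma_integrand.
under eq_integral do rewrite subrr powRr0 mul1r.
rewrite (@ge0_continuous_FTC2y _ _ (fun t => - expR (- t)) _ 0).
- by rewrite oppr0 expR0 EFinN oppeK add0e.
- by move=> t _; exact: expR_ge0.
- apply: continuous_subspaceT; exact: continuous_expRN.
- by rewrite -oppr0; apply: cvgN; exact: cvgr_expR.
- by move=> t _; exact: (@ex_derive _ _ _ _ _ _ _ (is_derive_oppr_expRN t)).
- apply/cvg_at_right_filter; apply: cvgN; exact: continuous_expRN.
- by move=> t _; rewrite derive1E;
  exact: (@derive_val _ _ _ _ _ _ _ (is_derive_oppr_expRN t)).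
Qed.

(** * Finiteness and positivity of Euler's integral *)

Lemma gamma_integral_nat {R : realType} (n : nat) :
  (gamma_integral (n.+1%:R : R) = (n`!%:R)%:E)%E.
Proof.
elim: n => [|n IH]; first exact: gamma_integral1.
by rewrite -natr1 gamma_integralS// IH -EFinM -natrM -factS.
Qed.

(** For [y >= 1] the integral is dominated by those at 1 and at an integer above [y], which are
    factorials. The functional equation carries finiteness from [x + 1] back to [x]. *)
Lemma gamma_integral_lty {R : realType} (x : R) : 0 < x ->
  (gamma_integral x < +oo)%E.
Proof.
have large (y : R) : 1 <= y -> (gamma_integral y < +oo)%E.
  move=> y1; pose n := Num.truncn y.
  (* The first summand, equal to 1, covers [t <= 1], the second covers [t > 1]; [1 - 1] matches the
     integrand of [gamma_integral 1]. *)
  have bound (t : R) : 0 < t -> t `^ (y - 1) <= t `^ (1 - 1) + t `^ (n.+1%:R - 1).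
    move=> t0; rewrite subrr powRr0 -natr1 addrK powR_mulrn ?(ltW t0)//.
    have [t1|t1] := leP t 1.
      apply: (@le_trans _ _ (1 `^ (y - 1))); last first.
        by rewrite powR1 lerDl exprn_ge0// ltW.
      apply: ge0_ler_powR => //.
      + by rewrite subr_ge0.
      + by rewrite nnegrE ltW.
      + by rewrite nnegrE.
    rewrite -powR_mulrn ?(ltW t0)//; apply: (@le_trans _ _ (t `^ n%:R)); last first.
      by rewrite lerDr.
    apply: ler_powR; first exact: ltW.
    by rewrite lerBlDr natr1 ltW// truncnS_gt.
  apply: (@le_lt_trans _ _ (gamma_integral (1 : R) + gamma_integral (n.+1%:R : R))%E).
    rewrite /gamma_integral -ge0_integralD//; first last.
    - exact: measurable_gamma_integrand.
    - by move=> t _; rewrite lee_fin gamma_integrand_ge0.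
    - exact: measurable_gamma_integrand.
    - by move=> t _; rewrite lee_fin gamma_integrand_ge0.
    apply: ge0_le_integral => //.
    - by move=> t _; rewrite lee_fin gamma_integrand_ge0.
    - exact: measurable_gamma_integrand.
    - by apply: emeasurable_funD; exact: measurable_gamma_integrand.
    - move=> t /=; rewrite in_itv/= andbT => t0.
      by rewrite -EFinD lee_fin -mulrDl ler_wpM2r ?expR_ge0 ?bound.
  by rewrite gamma_integral1 gamma_integral_nat -EFinD ltry.
move=> x0; have : (gamma_integral (x + 1) < +oo)%E by rewrite large// lerDr ltW.
(* If the integral at [x] were infinite, so would be its product with [x > 0]. *)
rewrite gamma_integralS//; apply: contraTT; rewrite -!leNgt !leye_eq => /eqP ->.
by rewrite gt0_muley.
Qed.

(** For [y >= 1] the integrand is at least [expR (- 2)] on the interval from 1 to 2, of measure 1;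
    smaller arguments follow by the functional equation. *)
Lemma gamma_integral_gt0 {R : realType} (x : R) : 0 < x ->
  (0 < gamma_integral x)%E.
Proof.
have large (y : R) : 1 <= y -> (0 < gamma_integral y)%E.
  move=> y1; have mu12 : (lebesgue_measure [set` `[1%R, 2%R]] = 1 :> \bar R)%E.
    by rewrite lebesgue_measure_itv/= lte_fin ltr1n -EFinB; congr EFin; ring.
  apply: (@lt_le_trans _ _
      (\int[lebesgue_measure]_(t in `[1%R, 2%R]) (expR (- 2 : R))%:E)%E).
    by rewrite integral_cst//= mu12 mule1 lte_fin expR_gt0.
  apply: (@le_trans _ _ (\int[lebesgue_measure]_(t in `[1%R, 2%R])
      (t `^ (y - 1) * expR (- t))%:E)%E).
    apply: ge0_le_integral => //.
    - exact: measurable_gamma_integrand.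
    - move=> t /=; rewrite in_itv/= => /andP[t1 t2]; rewrite lee_fin.
      rewrite -[leLHS]mul1r; apply: ler_pM; rewrite ?expR_ge0//; last first.
        by rewrite ler_expR lerN2.
      by rewrite -[leLHS](powRr0 (t : R)) ler_powR// subr_ge0.
  apply: ge0_subset_integral => //.
  - exact: measurable_gamma_integrand.
  - by move=> t _; rewrite lee_fin gamma_integrand_ge0.
  - move=> t /=; rewrite !in_itv/= andbT => /andP[t1 _]; exact: lt_le_trans t1.
move=> x0; have : (0 < gamma_integral (x + 1))%E by rewrite large// lerDr ltW.
by rewrite gamma_integralS// pmule_rgt0.
Qed.

(** * The real [Gamma] at positive arguments and the weights *)

(** Finiteness matters as much as positivity here, since [fine] sends [+oo] to 0. *)
Lemma Gamma_gt0 {R : realType} (x : R) : 0 < x -> 0 < Gamma x.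
Proof.
move=> x0; rewrite /Gamma x0; apply: fine_gt0.
by rewrite -/(gamma_integral x) gamma_integral_gt0// gamma_integral_lty.
Qed.

Lemma GammaS {R : realType} {x : R} : 0 < x -> Gamma (x + 1) = x * Gamma x.
Proof.
move=> x0; rewrite /Gamma x0 addr_gt0// /euler_Gamma /Rintegral.
rewrite -/(gamma_integral x) -/(gamma_integral (x + 1)) gamma_integralS//.
rewrite fineM// ge0_fin_numE ?gamma_integral_ge0// gamma_integral_lty//.
Qed.

Lemma Gamma1 {R : realType} : Gamma (1 : R) = 1.
Proof.
rewrite /Gamma ltr01 /euler_Gamma /Rintegral -/(gamma_integral (1 : R)).
by rewrite gamma_integral1.
Qed.

(* The coefficient of [f (b - j)] in the right sum at [b - beta - k] is
   [gamma_weight beta (k - j)]. *)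
Definition gamma_weight {R : realType} (beta : R) (m : nat) : R :=
  Gamma (m%:R + beta) / (Gamma beta * Gamma (m%:R + 1)).

Lemma gamma_weight0 {R : realType} (beta : R) : 0 < beta ->
  gamma_weight beta 0 = 1.
Proof.
by move=> b0; rewrite /gamma_weight !add0r Gamma1 mulr1 divff// gt_eqF// Gamma_gt0.
Qed.

Lemma gamma_weight_gt0 {R : realType} (beta : R) (m : nat) : 0 < beta ->
  0 < gamma_weight beta m.
Proof.
by move=> b0; rewrite divr_gt0 ?mulr_gt0// Gamma_gt0// ltr_wpDl.
Qed.

(** The functional equation is applied to numerator and denominator. For [beta = 1 - alpha] the
    factor is [1 - alpha / m.+1], which makes the weights decrease when [alpha > 0]. *)
Lemma gamma_weightS {R : realType} (beta : R) (m : nat) : 0 < beta ->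
  gamma_weight beta m.+1 = gamma_weight beta m * ((m%:R + beta) / m.+1%:R).
Proof.
move=> b0; have mb0 : 0 < m%:R + beta by rewrite ltr_wpDl.
have m1 : 0 < m%:R + 1 :> R by rewrite ltr_wpDl.
rewrite /gamma_weight -natr1 (addrAC m%:R) (GammaS mb0) (GammaS m1); field.
by rewrite !gt_eqF ?Gamma_gt0.
Qed.

(** * The right sum and difference as weighted sums *)

Lemma right_sum_weight {R : realType} (c beta : R) (f : R -> R) (k : nat) :
  right_sum c beta f (c - beta - k%:R) =
  \sum_(j < k.+1) gamma_weight beta (k - j) * f (c - j%:R).
Proof.
rewrite /right_sum.
(* The lower limit [t + beta] is [c - k], so the substitution [s = c - j] runs over [j <= k]. *)
rewrite (@reindex_fsbig _ _ _ _ _ (fun j : nat => c - j%:R) `I_k.+1); last first.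
  split => [j /= jk|i j _ _ /addrI/oppr_inj/eqP|s /= [[j ->{s}]]].
  - split; first by exists j.
    rewrite in_itv/= andbT addrAC subrK lerD2l lerN2 ler_nat; exact: jk.
  - by rewrite eqr_nat => /eqP.
  - rewrite in_itv/= andbT addrAC subrK lerD2l lerN2 ler_nat => jk.
    by exists j.
rewrite -(fsbig_ord _ _ (fun j =>
  falling (c - j%:R - sigma (c - beta - k%:R)) (beta - 1) * f (c - j%:R))).
rewrite mulr_sumr; apply: eq_bigr => j _.
have jk : (j <= k)%N by rewrite -ltnS.
rewrite /falling /sigma /gamma_weight natrB// mulrA; congr (_ * _).
(* The two [Gamma] arguments of the falling function become [k - j + beta] and [k - j + 1]; for
   [beta > 0] both are positive, so no pole occurs. *)
rewrite (_ : c - j%:R - (c - beta - k%:R + 1) + 1 = k%:R - j%:R + beta); last by ring.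
rewrite (_ : k%:R - j%:R + beta - (beta - 1) = k%:R - j%:R + 1); last by ring.
by rewrite invfM mulrCA.
Qed.

(** Passing from [k] to [k.+1] adds the term [f (c - k.+1)] with weight 1 and changes each older
    weight by the increment from [gamma_weightS]. *)
Lemma right_diff_weight {R : realType} (c alpha : R) (f : R -> R) (k : nat) :
  alpha < 1 ->
  right_diff c alpha f (c - (1 - alpha) - k%:R) = f (c - k.+1%:R) -
  \sum_(j < k.+1) alpha * gamma_weight (1 - alpha) (k - j) / (k - j).+1%:R
                   * f (c - j%:R).
Proof.
move=> a1; rewrite /right_diff /nabla opprB.
have -> : c - (1 - alpha) - k%:R - 1 = c - (1 - alpha) - k.+1%:R.
  by rewrite -natr1; ring.
rewrite !right_sum_weight big_ord_recr/= subnn gamma_weight0 ?subr_gt0// mul1r.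
rewrite addrAC addrC -sumrB -sumrN; congr (_ + _); apply: eq_bigr => j _.
have jk : (j <= k)%N by rewrite -ltnS.
rewrite subSn// gamma_weightS ?subr_gt0//; field.
by rewrite addrC natr1 pnatr_eq0.
Qed.

Theorem theorem4p6 (R : realType) (b : nat) (alpha : R) (f : R -> R)
    (b_gt0 : (0 < b)%N) (alpha_gt0 : 0 < alpha) (alpha_lt1 : alpha < 1)
    (fb_ge0 : 0 <= f b%:R)
    (diff_ge0 : forall u : R, downN (b%:R - (1 - alpha)) u ->
       0 <= right_diff b%:R alpha f u) :
  alpha_decreasing b%:R alpha f.
Proof.
have wge0 m : 0 <= alpha * gamma_weight (1 - alpha) m / m.+1%:R.
  by rewrite divr_ge0// mulr_ge0 ?ltW// gamma_weight_gt0// subr_gt0.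
have step k : \sum_(j < k.+1) alpha * gamma_weight (1 - alpha) (k - j)
    / (k - j).+1%:R * f (b%:R - j%:R) <= f (b%:R - k.+1%:R).
  by rewrite -subr_ge0 -right_diff_weight//; apply: diff_ge0; exists k.
have f_ge0 k : 0 <= f (b%:R - k%:R).
  (* The base case is [fb_ge0]; for [k.+1] the lower bound in [step] only involves values at indices
     up to [k]. *)
  elim/ltn_ind: k => -[_|k IH]; first by rewrite subr0.
  by apply: le_trans (step k); apply: sumr_ge0 => j _; rewrite mulr_ge0// IH.
move=> t [k ->].
have -> : b%:R - 1 - k%:R + 1 = b%:R - k%:R :> R by ring.
have -> : b%:R - 1 - k%:R = b%:R - k.+1%:R :> R by rewrite -natr1; ring.
(* The summand [j = k] has coefficient [alpha] exactly, because the weight at 0 is 1; the others are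
   nonnegative and are dropped. *)
apply: le_trans (step k); rewrite big_ord_recr/= subnn gamma_weight0 ?subr_gt0//.
by rewrite mulr1 divr1 lerDr sumr_ge0// => j _; rewrite mulr_ge0.
Qed.
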